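(* Let $\Lambda_3=(\lambda_0,\lambda_1,\lambda_2,\lambda_3)\in\mathbb{C}^4$. Then the following statements are equivalent: a) $\Lambda_3$ is symmetric. b) $\sigma$ is an odd function. c) The matrix $R$ is symmetric for every $n\ge 3$ and every choice of interpolation points $t_1<\dots<t_n$ (with $\Phi_{(\lambda_0,\lambda_1)}(t_{j+1}-t_j)\ne0$ and $\Phi_{(\lambda_2,\lambda_3)}(t_{j+1}-t_j)\neq0$ for $j=1,\dots,n-1$). d) $\Phi_{(\lambda_0,\lambda_1,\lambda_2,\lambda_3)}$ is an odd function.
   Context: A vector $(\mu_0,\dots,\mu_N)\in\mathbb{C}^{N+1}$ is symmetric if there is a permutation $p$ of $\{0,\dots,N\}$ with $-\mu_j=\mu_{p(j)}$ for all $j$. For $(\mu_0,\dots,\mu_N)\in\mathbb{C}^{N+1}$ let $\Phi_{(\mu_0,\dots,\mu_N)}$ (the fundamental function) be the unique solution of $\prod_{j=0}^N(\frac{d}{dx}-\mu_j)\Phi=0$ on $\mathbb{R}$ with $\Phi^{(k)}(0)=0$ for $k=0,\dots,N-1$ and $\Phi^{(N)}(0)=1$. Define, on the set of real $x$ where the denominators do not vanish (a set symmetric about $0$), $$\rho(x)=\frac{\Phi'_{(\lambda_0,\dots,\lambda_3)}(x)\Phi_{(\lambda_0,\lambda_1)}(x)-\Phi_{(\lambda_0,\dots,\lambda_3)}(x)\Phi'_{(\lambda_0,\lambda_1)}(x)}{\Phi_{(\lambda_0,\lambda_1)}(x)\Phi_{(\lambda_2,\lambda_3)}(x)},\qquad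 \sigma(x)=\frac{\Phi_{(\lambda_0,\dots,\lambda_3)}(x)}{\Phi_{(\lambda_0,\lambda_1)}(x)\Phi_{(\lambda_2,\lambda_3)}(x)}.$$ $R=(R_{i,j})_{2\le i,j\le n-1}$ is the tridiagonal $(n-2)\times(n-2)$ matrix with $$R_{j,j}=\rho(t_j-t_{j-1})-\rho(-(t_{j+1}-t_j)),\quad R_{j,j+1}=\sigma(t_{j+1}-t_j),\quad R_{j+1,j}=-\sigma(-(t_{j+1}-t_j)).$$ *)

(* Defs.v *)
(* Stdlib reals with Coquelicot; C is Coquelicot's field of complex numbers. *)
From Stdlib Require Import Reals List Arith FinFun ClassicalEpsilon FunctionalExtensionality.
From Stdlib Require Import Lra Lia.
From Coquelicot Require Import Coquelicot.
Import ListNotations.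

Open Scope R_scope.
Open Scope C_scope.

(* A vector (mu_0, ..., mu_N) is the list [mu_0; ...; mu_N], of length N + 1. *)
Definition symmetric_vector (mu : list C) : Prop :=
  exists p : nat -> nat,
    bFun (length mu) p /\ bInjective (length mu) p /\
    forall j, (j < length mu)%nat -> - nth j mu 0 = nth (p j) mu 0.

(* Derivative of a complex-valued function of a real variable. It is total, like
   Coquelicot's [Derive]; [CDeriv_correct] relates it to [is_derive]. *)
Definition CDeriv (f : R -> C) (x : R) : C :=
  (Derive (fun t => Re (f t)) x, Derive (fun t => Im (f t)) x).

Fixpoint CDeriv_n (f : R -> C) (k : nat) : R -> C :=
  match k with
  | O => f
  | S k => CDeriv (CDeriv_n f k)
  end.

Definition ex_CDeriv (f : R -> C) (x : R) : Prop :=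
  ex_derive (K := R_AbsRing) (V := C_R_NormedModule) f x.

Definition diff_op (mu : list C) (f : R -> C) : R -> C :=
  fold_right (fun m g x => CDeriv g x - m * g x) f mu.

(* The differentiability clause is needed because [CDeriv] is total. *)
Record is_fundamental_function (mu : list C) (Phi : R -> C) : Prop := {
  fundamental_diff : forall k x, (k < length mu)%nat -> ex_CDeriv (CDeriv_n Phi k) x;
  fundamental_ode : forall x, diff_op mu Phi x = 0;
  fundamental_init : forall k, (k < length mu - 1)%nat -> CDeriv_n Phi k 0%R = 0;
  fundamental_init_last : CDeriv_n Phi (length mu - 1) 0%R = 1
}.

(* For a nonempty list this is the unique solution of the initial value problem,
   see [fundamental_function_spec] and [is_fundamental_function_unique]. *)
Definition fundamental_function (mu : list C) : R -> C :=
  epsilon (A := R -> C) (inhabits (fun _ => RtoC 0)) (is_fundamental_function mu).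

Definition rho_sigma_domain (l0 l1 l2 l3 : C) (x : R) : Prop :=
  fundamental_function [l0; l1] x <> 0 /\ fundamental_function [l2; l3] x <> 0.

(* [rho_fun] and [sigma_fun] are only meaningful on [rho_sigma_domain]. *)
Definition rho_fun (l0 l1 l2 l3 : C) (x : R) : C :=
  (CDeriv (fundamental_function [l0; l1; l2; l3]) x * fundamental_function [l0; l1] x
   - fundamental_function [l0; l1; l2; l3] x * CDeriv (fundamental_function [l0; l1]) x)
  / (fundamental_function [l0; l1] x * fundamental_function [l2; l3] x).

Definition sigma_fun (l0 l1 l2 l3 : C) (x : R) : C :=
  fundamental_function [l0; l1; l2; l3] x
  / (fundamental_function [l0; l1] x * fundamental_function [l2; l3] x).

Definition odd_on (D : R -> Prop) (f : R -> C) : Prop :=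
  (forall x : R, D x -> D (- x)%R) /\
  (forall x : R, D x -> f (- x)%R = - f x).

(* Entry (i, j) of R, for 2 <= i, j <= n - 1; values at other indices are junk. *)
Definition Rmat (l0 l1 l2 l3 : C) (t : nat -> R) (i j : nat) : C :=
  if (i =? j)%nat then
    rho_fun l0 l1 l2 l3 (t j - t (j - 1)%nat)%R - rho_fun l0 l1 l2 l3 (- (t (j + 1)%nat - t j))%R
  else if (j =? i + 1)%nat then sigma_fun l0 l1 l2 l3 (t (i + 1)%nat - t i)%R
  else if (i =? j + 1)%nat then - sigma_fun l0 l1 l2 l3 (- (t (j + 1)%nat - t j))%R
  else 0.

Definition symmetric_matrix (n : nat) (A : nat -> nat -> C) : Prop :=
  forall i j, (2 <= i <= n - 1)%nat -> (2 <= j <= n - 1)%nat -> A i j = A j i.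

Definition interpolation_points (l0 l1 l2 l3 : C) (n : nat) (t : nat -> R) : Prop :=
  (forall j, (1 <= j <= n - 1)%nat -> (t j < t (j + 1)%nat)%R) /\
  (forall j, (1 <= j <= n - 1)%nat ->
     rho_sigma_domain l0 l1 l2 l3 (t (j + 1)%nat - t j)%R).

Definition is_CDeriv (f : R -> C) (x : R) (l : C) : Prop :=
  is_derive (K := R_AbsRing) (V := C_R_NormedModule) f x l.

Lemma is_CDeriv_pair (f : R -> C) (x : R) (l : C) :
  is_CDeriv f x l <->
  is_derive (fun t => Re (f t)) x (Re l) /\ is_derive (fun t => Im (f t)) x (Im l).
Proof.
  split.
  - intros H. split.
    + apply (filterdiff_comp (U := R_NormedModule) (V := C_R_NormedModule) (W := R_NormedModule)
        f (fun c => Re c) (fun y : R => scal y l) (fun c => Re c)); [exact H|].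
      apply filterdiff_linear, is_linear_fst.
    + apply (filterdiff_comp (U := R_NormedModule) (V := C_R_NormedModule) (W := R_NormedModule)
        f (fun c => Im c) (fun y : R => scal y l) (fun c => Im c)); [exact H|].
      apply filterdiff_linear, is_linear_snd.
  - intros [H1 H2].
    apply (filterdiff_ext_lin
      (U := R_NormedModule) (V := C_R_NormedModule) f
      (fun y : R => (scal y (Re l), scal y (Im l)))).
    2: { intros y. destruct l; reflexivity. }
    apply (filterdiff_ext (U := R_NormedModule) (V := C_R_NormedModule)
      (fun t => (Re (f t), Im (f t)))).
    { intros t. destruct (f t); reflexivity. }
    apply (filterdiff_comp'_2 (T := R_NormedModule) (U := R_NormedModule)
      (V := R_NormedModule) (W := C_R_NormedModule)
      (fun t => Re (f t)) (fun t => Im (f t)) (fun u v : R => (u, v)) x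
      (fun y : R => scal y (Re l)) (fun y : R => scal y (Im l)) (fun u v : R => (u, v)) H1 H2).
    apply (filterdiff_ext (fun t => t)). { intros [a b]; reflexivity. }
    apply (filterdiff_ext_lin _ (fun t => t)). { apply filterdiff_id. }
    intros [a b]; reflexivity.
Qed.

Lemma CDeriv_correct (f : R -> C) (x : R) (l : C) : is_CDeriv f x l -> CDeriv f x = l.
Proof.
  intros [H1 H2]%is_CDeriv_pair. apply injective_projections.
  - exact (is_derive_unique _ _ _ H1).
  - exact (is_derive_unique _ _ _ H2).
Qed.

Lemma ex_CDeriv_correct (f : R -> C) (x : R) : ex_CDeriv f x -> is_CDeriv f x (CDeriv f x).
Proof. intros [l H]. now rewrite (CDeriv_correct _ _ _ H). Qed.

Lemma is_CDeriv_const (c : C) (x : R) : is_CDeriv (fun _ => c) x 0.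
Proof. exact (is_derive_const (K := R_AbsRing) (V := C_R_NormedModule) c x). Qed.

Lemma is_CDeriv_plus (f g : R -> C) (x : R) (a b : C) :
  is_CDeriv f x a -> is_CDeriv g x b -> is_CDeriv (fun t => f t + g t) x (a + b).
Proof. exact (is_derive_plus (K := R_AbsRing) (V := C_R_NormedModule) f g x a b). Qed.

Lemma is_CDeriv_minus (f g : R -> C) (x : R) (a b : C) :
  is_CDeriv f x a -> is_CDeriv g x b -> is_CDeriv (fun t => f t - g t) x (a - b).
Proof. exact (is_derive_minus (K := R_AbsRing) (V := C_R_NormedModule) f g x a b). Qed.

Lemma is_CDeriv_mult (f g : R -> C) (x : R) (a b : C) :
  is_CDeriv f x a -> is_CDeriv g x b ->
  is_CDeriv (fun t => f t * g t) x (a * g x + f x * b).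
Proof.
  intros [A1 A2]%is_CDeriv_pair [B1 B2]%is_CDeriv_pair. apply is_CDeriv_pair.
  assert (M : forall (u v : R -> R) (p q : R), is_derive u x p -> is_derive v x q ->
    is_derive (fun t => u t * v t)%R x (p * v x + u x * q)%R).
  { intros u v p q Hu Hv. apply (is_derive_mult u v x p q Hu Hv). intros; apply Rmult_comm. }
  split.
  - evar_last.
    + exact (is_derive_minus _ _ _ _ _ (M _ _ _ _ A1 B1) (M _ _ _ _ A2 B2)).
    + unfold minus, plus, opp; simpl. unfold Re, Im. ring.
  - evar_last.
    + exact (is_derive_plus _ _ _ _ _ (M _ _ _ _ A1 B2) (M _ _ _ _ A2 B1)).
    + unfold minus, plus, opp; simpl. unfold Re, Im. ring.
Qed.

Lemma is_CDeriv_scal (m : C) (f : R -> C) (x : R) (a : C) :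
  is_CDeriv f x a -> is_CDeriv (fun t => m * f t) x (m * a).
Proof.
  intros H. evar_last. { exact (is_CDeriv_mult _ _ _ _ _ (is_CDeriv_const m x) H). }
  simpl. ring.
Qed.

Definition cexp (m : C) (x : R) : C :=
  (exp (Re m * x) * cos (Im m * x), exp (Re m * x) * sin (Im m * x))%R.

Lemma is_CDeriv_cexp (m : C) (x : R) : is_CDeriv (cexp m) x (m * cexp m x).
Proof.
  apply is_CDeriv_pair. destruct m as [a b]. unfold cexp, Re, Im; simpl.
  split; auto_derive; auto; ring.
Qed.

Lemma cexp_0 (m : C) : cexp m 0%R = 1.
Proof.
  unfold cexp. rewrite !Rmult_0_r, exp_0, cos_0, sin_0.
  apply injective_projections; simpl; ring.
Qed.

Lemma is_CDeriv_zero (f : R -> C) :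
  (forall x, is_CDeriv f x 0) -> forall x, f x = f 0%R.
Proof.
  intros H x. apply injective_projections.
  - destruct (MVT_gen (fun t => Re (f t)) 0 x (fun _ => 0%R)) as [c [_ E]].
    + intros y _. apply (proj1 (is_CDeriv_pair _ _ _) (H y)).
    + intros y _. apply continuity_pt_filterlim.
      apply (ex_derive_continuous (fun t => Re (f t))).
      exists (Re 0). apply (proj1 (is_CDeriv_pair f y 0) (H y)).
    + unfold Re in *. lra.
  - destruct (MVT_gen (fun t => Im (f t)) 0 x (fun _ => 0%R)) as [c [_ E]].
    + intros y _. apply (proj1 (is_CDeriv_pair _ _ _) (H y)).
    + intros y _. apply continuity_pt_filterlim.
      apply (ex_derive_continuous (fun t => Im (f t))).
      exists (Im 0). apply (proj1 (is_CDeriv_pair f y 0) (H y)).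
    + unfold Im in *. lra.
Qed.

Lemma cexp_opp (m : C) (x : R) : cexp m x * cexp (- m) x = 1.
Proof.
  transitivity (cexp m 0%R * cexp (- m) 0%R); [|rewrite !cexp_0; ring].
  apply (is_CDeriv_zero (fun t => cexp m t * cexp (- m) t)). intros y.
  evar_last. { apply is_CDeriv_mult; apply is_CDeriv_cexp. } simpl. ring.
Qed.

Lemma first_order_zero (m : C) (h : R -> C) :
  (forall x, is_CDeriv h x (m * h x)) -> h 0%R = 0 -> forall x, h x = 0.
Proof.
  intros H H0 x.
  assert (E : h x * cexp (- m) x = 0).
  { rewrite (is_CDeriv_zero (fun t => h t * cexp (- m) t)); [rewrite H0; ring|].
    intros y. evar_last. { apply is_CDeriv_mult; [apply H | apply is_CDeriv_cexp]. }
    simpl. ring. }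
  transitivity (h x * (cexp m x * cexp (- m) x)); [rewrite cexp_opp; ring|].
  transitivity (cexp m x * (h x * cexp (- m) x)); [ring|]. rewrite E. ring.
Qed.

Lemma primitive_exists (f : R -> C) :
  (forall x, ex_CDeriv f x) ->
  exists F : R -> C, F 0%R = 0 /\ forall x, is_CDeriv F x (f x).
Proof.
  intros Hf.
  assert (P : forall g : R -> R, (forall x, ex_derive g x) ->
    forall x, is_derive (fun y => RInt g 0 y) x (g x)).
  { intros g Hg x. apply (is_derive_RInt g (fun y => RInt g 0 y) 0 x).
    - apply filter_forall. intros y. apply (RInt_correct g).
      apply (ex_RInt_continuous g). intros z _. now apply (ex_derive_continuous g).
    - now apply (ex_derive_continuous g). }
  exists (fun x => (RInt (fun t => Re (f t)) 0 x, RInt (fun t => Im (f t)) 0 x)). split.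
  - now rewrite !RInt_point.
  - intros x. apply is_CDeriv_pair. split.
    + apply (P (fun t => Re (f t))). intros y. destruct (Hf y) as [l Hl].
      apply is_CDeriv_pair in Hl. exists (Re l). apply Hl.
    + apply (P (fun t => Im (f t))). intros y. destruct (Hf y) as [l Hl].
      apply is_CDeriv_pair in Hl. exists (Im l). apply Hl.
Qed.

Lemma first_order_exists (m : C) (f : R -> C) :
  (forall x, ex_CDeriv f x) ->
  exists F : R -> C, F 0%R = 0 /\ forall x, is_CDeriv F x (m * F x + f x).
Proof.
  intros Hf. destruct (primitive_exists (fun t => cexp (- m) t * f t)) as [G [G0 HG]].
  { intros x. destruct (Hf x) as [l Hl]. eexists.
    apply is_CDeriv_mult; [apply is_CDeriv_cexp | exact Hl]. }
  exists (fun t => cexp m t * G t). split. { rewrite G0. ring. }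
  intros x. evar_last. { apply is_CDeriv_mult; [apply is_CDeriv_cexp | apply HG]. }
  simpl. transitivity (m * (cexp m x * G x) + cexp m x * cexp (- m) x * f x); [ring|].
  rewrite cexp_opp. ring.
Qed.

Definition smooth (f : R -> C) : Prop := forall k x, ex_CDeriv (CDeriv_n f k) x.

Lemma CDeriv_n_step (m : C) (F f : R -> C) :
  smooth f -> (forall x, is_CDeriv F x (m * F x + f x)) ->
  forall k x, is_CDeriv (CDeriv_n F k) x (m * CDeriv_n F k x + CDeriv_n f k x).
Proof.
  intros Hf HF. induction k as [|k IH]; intros x; [exact (HF x)|].
  cbn [CDeriv_n].
  apply (is_derive_ext (K := R_AbsRing) (V := C_R_NormedModule)
    (fun t => m * CDeriv_n F k t + CDeriv_n f k t)).
  { intros t. symmetry. apply CDeriv_correct, IH. }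
  apply is_CDeriv_plus.
  - apply is_CDeriv_scal, ex_CDeriv_correct. eexists; apply IH.
  - apply ex_CDeriv_correct, Hf.
Qed.

Lemma diff_op_snoc (l : list C) (m : C) (f : R -> C) :
  diff_op (l ++ [m]) f = diff_op l (fun x => CDeriv f x - m * f x).
Proof. unfold diff_op. now rewrite fold_right_app. Qed.

Lemma fundamental_exists_smooth (mu : list C) :
  mu <> nil -> exists Phi, smooth Phi /\ is_fundamental_function mu Phi.
Proof.
  induction mu as [|m l IH] using rev_ind; [easy|]. intros _.
  destruct l as [|m0 l0].
  - assert (S : smooth (cexp m)).
    { intros k x.
      assert (E : is_CDeriv (CDeriv_n (cexp m) k) x (m * CDeriv_n (cexp m) k x)).
      { revert x. induction k as [|k IHk]; intros x; [apply is_CDeriv_cexp|]. cbn [CDeriv_n].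
        apply (is_derive_ext (K := R_AbsRing) (V := C_R_NormedModule)
          (fun t => m * CDeriv_n (cexp m) k t)).
        { intros t. symmetry. apply CDeriv_correct, IHk. }
        apply is_CDeriv_scal, ex_CDeriv_correct. eexists; apply IHk. }
      eexists; apply E. }
    exists (cexp m). split; [exact S|]. split; cbn.
    + intros k x _. apply S.
    + intros x. rewrite (CDeriv_correct _ _ _ (is_CDeriv_cexp m x)). ring.
    + intros k Hk; lia.
    + apply cexp_0.
  - destruct IH as [f [Sf Hf]]; [easy|]. remember (m0 :: l0) as l eqn:El.
    assert (Hl : (0 < length l)%nat) by (subst l; cbn; lia). clear El m0 l0.
    destruct (first_order_exists m f) as [F [F0 HF]]. { apply (Sf 0%nat). }
    pose proof (CDeriv_n_step m F f Sf HF) as D.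
    assert (SF : smooth F). { intros k x. eexists; apply D. }
    assert (Z : forall k, (k < length l)%nat -> CDeriv_n F k 0%R = 0).
    { induction k as [|k IHk]; intros Hk; [exact F0|]. cbn [CDeriv_n].
      rewrite (CDeriv_correct _ _ _ (D k 0%R)), IHk by lia.
      rewrite (fundamental_init _ _ Hf) by lia. ring. }
    exists F. split; [exact SF|]. split.
    + intros k x _. apply SF.
    + intros x. rewrite diff_op_snoc, <- (fundamental_ode _ _ Hf x). do 2 f_equal.
      apply functional_extensionality. intros y. rewrite (CDeriv_correct _ _ _ (HF y)). ring.
    + rewrite length_app; cbn. intros k Hk. apply Z. lia.
    + rewrite length_app; cbn [length].
      replace (length l + 1 - 1)%nat with (S (length l - 1)) by lia. cbn [CDeriv_n].
      rewrite (CDeriv_correct _ _ _ (D _ 0%R)), Z by lia.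
      rewrite (fundamental_init_last _ _ Hf). ring.
Qed.

Lemma fundamental_function_spec (mu : list C) :
  mu <> nil -> is_fundamental_function mu (fundamental_function mu).
Proof.
  intros H. unfold fundamental_function. apply epsilon_spec.
  destruct (fundamental_exists_smooth mu H) as [Phi [_ HPhi]]. now exists Phi.
Qed.

Lemma diff_op_determined (mu : list C) (f g : R -> C) :
  (forall k x, (k < length mu)%nat -> ex_CDeriv (CDeriv_n f k) x) ->
  (forall k x, (k < length mu)%nat -> ex_CDeriv (CDeriv_n g k) x) ->
  (forall k, (k < length mu)%nat -> CDeriv_n f k 0%R = CDeriv_n g k 0%R) ->
  (forall x, diff_op mu f x = diff_op mu g x) ->
  forall x, f x = g x.
Proof.
  revert f g. induction mu as [|m l IH] using rev_ind; intros f g Hf Hg H0 HE; [exact HE|].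
  rewrite length_app in Hf, Hg, H0; cbn [length] in Hf, Hg, H0.
  assert (D : forall h, (forall k x, (k < length l + 1)%nat -> ex_CDeriv (CDeriv_n h k) x) ->
    forall k, (k < length l + 1)%nat ->
      CDeriv_n (fun x => CDeriv h x - m * h x) k =
      (fun x => CDeriv_n h (S k) x - m * CDeriv_n h k x)).
  { intros h Hh. induction k as [|k IHk]; intros Hk; [reflexivity|].
    cbn [CDeriv_n]. rewrite IHk by lia. apply functional_extensionality. intros x.
    apply CDeriv_correct. apply is_CDeriv_minus.
    - apply ex_CDeriv_correct. apply (Hh (S k)). lia.
    - apply is_CDeriv_scal, ex_CDeriv_correct. apply (Hh k). lia. }
  assert (X : forall h, (forall k x, (k < length l + 1)%nat -> ex_CDeriv (CDeriv_n h k) x) ->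
    forall k x, (k < length l)%nat ->
      ex_CDeriv (CDeriv_n (fun x => CDeriv h x - m * h x) k) x).
  { intros h Hh k x Hk. rewrite D by (auto; lia). eexists. apply is_CDeriv_minus.
    - apply ex_CDeriv_correct. apply (Hh (S k)). lia.
    - apply is_CDeriv_scal, ex_CDeriv_correct. apply (Hh k). lia. }
  assert (E : forall x, CDeriv f x - m * f x = CDeriv g x - m * g x).
  { apply (IH (fun x => CDeriv f x - m * f x) (fun x => CDeriv g x - m * g x)).
    - now apply X.
    - now apply X.
    - intros k Hk. rewrite !D by (auto; lia). rewrite !H0 by lia. reflexivity.
    - intros x. rewrite <- (diff_op_snoc l m f), <- (diff_op_snoc l m g). apply HE. }
  intros x.
  assert (Z : f x - g x = 0).
  { apply (first_order_zero m (fun t => f t - g t)).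
    - intros y. evar_last.
      + apply is_CDeriv_minus; apply ex_CDeriv_correct.
        * apply (Hf 0%nat); lia.
        * apply (Hg 0%nat); lia.
      + simpl. transitivity ((CDeriv f y - m * f y) - CDeriv g y + m * f y); [ring|].
        rewrite E. ring.
    - specialize (H0 0%nat ltac:(lia)). cbn in H0. rewrite H0. ring. }
  transitivity (f x - g x + g x); [ring|]. rewrite Z. ring.
Qed.

Lemma is_fundamental_function_unique (mu : list C) (f g : R -> C) :
  is_fundamental_function mu f -> is_fundamental_function mu g -> forall x, f x = g x.
Proof.
  intros Hf Hg. apply (diff_op_determined mu).
  - apply Hf.
  - apply Hg.
  - intros k Hk. destruct (Nat.eq_dec k (length mu - 1)) as [->|N].
    + now rewrite (fundamental_init_last _ _ Hf), (fundamental_init_last _ _ Hg).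
    + now rewrite (fundamental_init _ _ Hf), (fundamental_init _ _ Hg) by lia.
  - intros x. now rewrite (fundamental_ode _ _ Hf), (fundamental_ode _ _ Hg).
Qed.

(* Main.v *)
Require Import Defs.
From Stdlib Require Import Reals List.
From Stdlib Require Import Lra Lia Permutation FunctionalExtensionality.
From Coquelicot Require Import Coquelicot.
Import ListNotations.
Open Scope R_scope.
Open Scope C_scope.

(** Write Phi_l for the fundamental function of a list l of exponents, and D for d/dx.
    Everything reduces to comparing Phi_l with Phi_{c - l}, where c - l is the list of
    the c - m for m in l, through two facts.

    Reflection ([fundamental_function_reflect]): if l has N + 1 entries, then
    Phi_{c - l} (x) = (-1)^N e^{c x} Phi_l (-x). Indeed g(x) = e^{c x} f(-x) satisfies
    (D - (c - m)) g (x) = - e^{c x} ((D - m) f) (-x), so the right-hand side obeys the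
    first-order recursion that determines fundamental functions:
    (D - m) Phi_{l ++ [m]} = Phi_l with Phi_{l ++ [m]} (0) = 0.

    Injectivity ([fundamental_eq_Permutation]): if Phi_l and Phi_l' agree near 0 and
    l, l' have the same length, then l' is a permutation of l. For l = m :: r the
    operator of r maps Phi_l to e^{m x}; the operator of l' kills Phi_l near 0 and
    commutes with that of r, so it kills e^{m x} at 0. The value there is the product of
    the m - m' for m' in l', hence m occurs in l'. Apply D - m to cancel it on both
    sides, and conclude by induction.

    A vector is symmetric exactly when it is a permutation of its opposite
    ([symmetric_vector_Permutation]). With c = 0 and four exponents, reflection turns
    oddness of Phi_l into Phi_{- l} = Phi_l, which is the equivalence of a) and d).

    For sigma, let s be the sum of the four exponents. Reflection with two exponents
    a, b and c = a + b gives Phi_{a,b} (-x) = - e^{- (a + b) x} Phi_{a,b} (x), so the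
    denominator of sigma at -x is e^{- s x} times the one at x, and
    sigma (-x) = - Phi_{s - l} (x) / (Phi_{l0,l1} (x) Phi_{l2,l3} (x))
    ([sigma_opp]). Since the denominators do not vanish at small nonzero x, oddness of
    sigma says that Phi_{s - l} = Phi_l near 0, that is, s - l is a permutation of l.
    Comparing sums gives 4 s - s = s, so s = 0 and l is symmetric.

    Finally, the only entries of R that symmetry compares are sigma (h) and - sigma (- h)
    for gaps h; four equidistant points realize every admissible h > 0. *)

(** * Differential operators with constant coefficients *)

Lemma CDeriv_n_shift (f : R -> C) (m : C) (k : nat) :
  smooth f ->
  CDeriv_n (fun x => CDeriv f x - m * f x) k
  = (fun x => CDeriv_n f (S k) x - m * CDeriv_n f k x).
Proof.
  intros Hf. induction k as [|k IHk]; [reflexivity|].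
  cbn [CDeriv_n]. rewrite IHk. apply functional_extensionality. intros x.
  apply CDeriv_correct, is_CDeriv_minus.
  - apply ex_CDeriv_correct, (Hf (S k)).
  - apply is_CDeriv_scal, ex_CDeriv_correct, (Hf k).
Qed.

Lemma smooth_shift (f : R -> C) (m : C) :
  smooth f -> smooth (fun x => CDeriv f x - m * f x).
Proof.
  intros Hf k x. rewrite CDeriv_n_shift by exact Hf. eexists. apply is_CDeriv_minus.
  - apply ex_CDeriv_correct, (Hf (S k)).
  - apply is_CDeriv_scal, ex_CDeriv_correct, (Hf k).
Qed.

Lemma smooth_diff_op (l : list C) (f : R -> C) : smooth f -> smooth (diff_op l f).
Proof.
  intros Hf. induction l as [|m l IH]; [exact Hf|]. exact (smooth_shift _ m IH).
Qed.

Lemma diff_op_app (l l' : list C) (f : R -> C) :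
  diff_op (l ++ l') f = diff_op l (diff_op l' f).
Proof. apply fold_right_app. Qed.

(** First-order factors commute when all derivatives exist; [CDeriv] being total, smoothness is
    what makes it additive. *)
Lemma diff_op_Permutation (l l' : list C) (f : R -> C) :
  Permutation l l' -> smooth f -> diff_op l f = diff_op l' f.
Proof.
  intros HP Hf. induction HP as [|m l l' _ IH|a b l|l l' l'' _ IH1 _ IH2].
  - reflexivity.
  - apply functional_extensionality. intros x.
    change (CDeriv (diff_op l f) x - m * diff_op l f x
            = CDeriv (diff_op l' f) x - m * diff_op l' f x).
    now rewrite IH.
  - pose proof (smooth_diff_op l f Hf) as Hg. set (g := diff_op l f) in *.
    assert (D : forall c x,
      CDeriv (fun y => CDeriv g y - c * g y) x = CDeriv (CDeriv g) x - c * CDeriv g x).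
    { intros c x. exact (f_equal (fun h => h x) (CDeriv_n_shift g c 1 Hg)). }
    apply functional_extensionality. intros x.
    change (CDeriv (fun y => CDeriv g y - a * g y) x - b * (CDeriv g x - a * g x)
            = CDeriv (fun y => CDeriv g y - b * g y) x - a * (CDeriv g x - b * g x)).
    rewrite !D. ring.
  - now rewrite IH1.
Qed.

(** Differential operators are local. The conclusion is a neighbourhood statement so that further
    operators can be applied to it. *)
Lemma diff_op_ext_loc (l : list C) (f g : R -> C) (x : R) :
  locally x (fun y => f y = g y) -> locally x (fun y => diff_op l f y = diff_op l g y).
Proof.
  intros H. induction l as [|m l IH]; [exact H|].
  apply locally_locally in IH. revert IH. apply filter_imp. intros y Hy.
  change (CDeriv (diff_op l f) y - m * diff_op l f y
          = CDeriv (diff_op l g) y - m * diff_op l g y).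
  rewrite (locally_singleton _ _ Hy). f_equal. unfold CDeriv.
  f_equal; apply Derive_ext_loc; revert Hy; apply filter_imp; now intros z ->.
Qed.

Lemma diff_op_zero (l : list C) (x : R) : diff_op l (fun _ => 0) x = 0.
Proof.
  assert (E : diff_op l (fun _ => 0) = (fun _ => 0)).
  { induction l as [|m l IH]; [reflexivity|].
    apply functional_extensionality. intros y.
    change (CDeriv (diff_op l (fun _ => 0)) y - m * diff_op l (fun _ => 0) y = 0).
    rewrite IH, (CDeriv_correct _ _ _ (is_CDeriv_const 0 y)). ring. }
  now rewrite E.
Qed.

(** Exponentials are eigenfunctions; the eigenvalue is the characteristic polynomial at [m]. *)
Lemma diff_op_cexp (l : list C) (m : C) :
  diff_op l (cexp m) = (fun x => fold_right Cmult 1 (map (Cminus m) l) * cexp m x).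
Proof.
  induction l as [|a l IH]; apply functional_extensionality; intros x.
  - cbn. ring.
  - change (CDeriv (diff_op l (cexp m)) x - a * diff_op l (cexp m) x
            = (m - a) * fold_right Cmult 1 (map (Cminus m) l) * cexp m x).
    rewrite IH.
    rewrite (CDeriv_correct _ _ _ (is_CDeriv_scal _ _ _ _ (is_CDeriv_cexp m x))). ring.
Qed.

Lemma Cmult_fold_zero (l : list C) : fold_right Cmult 1 l = 0 -> In (RtoC 0) l.
Proof.
  induction l as [|a l IH]; cbn; intros H.
  - now destruct C1_nz.
  - destruct (Ceq_dec a 0) as [->|Ha]; [now left|].
    right. apply IH.
    destruct (Ceq_dec (fold_right Cmult 1 l) 0) as [E|E]; [exact E|].
    now destruct (Cmult_neq_0 _ _ Ha E).
Qed.

Lemma cexp_plus (a b : C) (x : R) : cexp (a + b) x = cexp a x * cexp b x.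
Proof.
  unfold cexp. destruct a as [a1 a2], b as [b1 b2]. unfold Re, Im. cbn [fst snd Cplus].
  rewrite !Rmult_plus_distr_r, exp_plus, cos_plus, sin_plus.
  apply injective_projections; simpl; ring.
Qed.

Lemma cexp_neq_0 (m : C) (x : R) : cexp m x <> 0.
Proof.
  intros E. apply C1_nz. rewrite <- (cexp_opp m x), E. ring.
Qed.

Lemma is_CDeriv_reflect (f : R -> C) (x : R) (l : C) :
  is_CDeriv f (- x)%R l -> is_CDeriv (fun t => f (- t)%R) x (- l).
Proof.
  intros [H1 H2]%is_CDeriv_pair. apply is_CDeriv_pair.
  assert (N : is_derive (fun t : R => (- t)%R) x (-1)%R) by (auto_derive; auto; ring).
  split; (evar_last; [eapply (is_derive_comp (fun t => _ (f t)) (fun t : R => (- t)%R)); eassumption|]);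
    unfold scal; simpl; unfold mult, Re, Im; simpl; ring.
Qed.

(** The common way to identify two functions below: same first-order equation, same initial value. *)
Lemma first_order_unique (m : C) (f g r : R -> C) :
  (forall x, is_CDeriv f x (m * f x + r x)) ->
  (forall x, is_CDeriv g x (m * g x + r x)) ->
  f 0%R = g 0%R -> forall x, f x = g x.
Proof.
  intros Hf Hg H0 x.
  assert (Z : f x - g x = 0).
  { apply (first_order_zero m (fun t => f t - g t)); [|rewrite H0; ring].
    intros y. evar_last; [apply is_CDeriv_minus; [apply Hf | apply Hg]|]. simpl. ring. }
  transitivity (f x - g x + g x); [ring|]. rewrite Z. ring.
Qed.

(** * Fundamental functions *)

Lemma smooth_fundamental_function (mu : list C) :
  mu <> nil -> smooth (fundamental_function mu).
Proof.
  intros H. destruct (fundamental_exists_smooth mu H) as [F [SF HF]].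
  replace (fundamental_function mu) with F; [exact SF|].
  apply functional_extensionality, (is_fundamental_function_unique mu); [exact HF|].
  now apply fundamental_function_spec.
Qed.

Lemma fundamental_function_Permutation (l l' : list C) :
  l <> nil -> Permutation l l' -> forall x, fundamental_function l x = fundamental_function l' x.
Proof.
  intros Hl HP. pose proof (Permutation_length HP) as HL.
  assert (Hl' : l' <> nil).
  { intros ->. now apply Hl, Permutation_nil, Permutation_sym. }
  apply (is_fundamental_function_unique l'); [|now apply fundamental_function_spec].
  pose proof (smooth_fundamental_function l Hl) as HS.
  pose proof (fundamental_function_spec l Hl) as [H1 H2 H3 H4].
  rewrite HL in H1, H3, H4. split; auto.
  intros x. now rewrite <- (diff_op_Permutation l l').
Qed.

Lemma fundamental_function_singleton (m : C) (x : R) : fundamental_function [m] x = cexp m x.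
Proof.
  pose proof (smooth_fundamental_function [m] ltac:(easy)) as HS.
  pose proof (fundamental_function_spec [m] ltac:(easy)) as [_ H2 _ H4].
  cbn in H2, H4.
  apply (first_order_unique m _ _ (fun _ => 0)).
  - intros y. evar_last; [apply ex_CDeriv_correct, (HS 0%nat)|]. cbn [CDeriv_n].
    transitivity (CDeriv (fundamental_function [m]) y - m * fundamental_function [m] y
                  + m * fundamental_function [m] y); [ring|]. rewrite H2. ring.
  - intros y. evar_last; [apply is_CDeriv_cexp|]. simpl. ring.
  - now rewrite H4, cexp_0.
Qed.

(** Removing the last factor shifts the initial conditions by one order: the k-th derivative of
    (D - m) Phi at 0 is Phi^(k+1)(0) - m Phi^(k)(0). This reduces the theory of fundamental
    functions to first-order equations. *)
Lemma fundamental_function_peel (l : list C) (m : C) :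
  l <> nil ->
  (fun x => CDeriv (fundamental_function (l ++ [m])) x - m * fundamental_function (l ++ [m]) x)
  = fundamental_function l.
Proof.
  intros Hl.
  assert (Hlm : l ++ [m] <> nil) by now destruct l.
  assert (Hp : (0 < length l)%nat) by (destruct l; [easy | cbn; lia]).
  pose proof (smooth_fundamental_function _ Hlm) as HS.
  pose proof (fundamental_function_spec _ Hlm) as [_ H2 H3 H4].
  rewrite length_app in H3, H4. cbn [length] in H3, H4.
  set (F := fundamental_function (l ++ [m])) in *.
  apply functional_extensionality.
  apply (is_fundamental_function_unique l); [|now apply fundamental_function_spec].
  split.
  - intros k x _. now apply smooth_shift.
  - intros x. rewrite <- diff_op_snoc. apply H2.
  - intros k Hk. rewrite CDeriv_n_shift, !H3 by (exact HS || lia). ring.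
  - rewrite CDeriv_n_shift by exact HS.
    replace (S (length l - 1)) with (length l + 1 - 1)%nat by lia.
    rewrite H4, H3 by lia. ring.
Qed.

Lemma is_CDeriv_fundamental_snoc (l : list C) (m : C) (x : R) :
  l <> nil ->
  is_CDeriv (fundamental_function (l ++ [m])) x
    (m * fundamental_function (l ++ [m]) x + fundamental_function l x).
Proof.
  intros Hl. evar_last.
  - apply ex_CDeriv_correct, (smooth_fundamental_function (l ++ [m]) ltac:(now destruct l) 0%nat).
  - cbn [CDeriv_n]. rewrite <- (fundamental_function_peel l m Hl). simpl. ring.
Qed.

Lemma fundamental_snoc_0 (l : list C) (m : C) :
  l <> nil -> fundamental_function (l ++ [m]) 0%R = 0.
Proof.
  intros Hl. pose proof (fundamental_function_spec (l ++ [m]) ltac:(now destruct l)) as H.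
  apply (fundamental_init _ _ H 0%nat). rewrite length_app. destruct l; [easy | cbn; lia].
Qed.

(** By induction on the list, both sides solve the same first-order problem. Allowing a shift [c]
    besides the reflection costs nothing; [c = 0] handles the oddness of Phi and [c] the sum of
    the exponents handles sigma. *)
Lemma fundamental_function_reflect (c : C) (l : list C) (x : R) :
  l <> nil ->
  fundamental_function (map (Cminus c) l) x
  = (- 1) ^ (length l - 1) * (cexp c x * fundamental_function l (- x)%R).
Proof.
  revert x. induction l as [|m l IH] using rev_ind; intros x; [easy|]. intros _.
  rewrite map_app, length_app. cbn [map length].
  destruct l as [|a l].
  - cbn [map app length]. rewrite !fundamental_function_singleton. cbn.
    apply (first_order_unique (c - m) (cexp (c - m))
      (fun t => 1 * (cexp c t * cexp m (- t)%R)) (fun _ => 0)).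
    + intros y. evar_last; [apply is_CDeriv_cexp|]. simpl. ring.
    + intros y. evar_last.
      { apply is_CDeriv_scal, is_CDeriv_mult; [apply is_CDeriv_cexp|].
        apply is_CDeriv_reflect, is_CDeriv_cexp. }
      simpl. ring.
    + rewrite Ropp_0, !cexp_0. ring.
  - remember (a :: l) as l' eqn:E.
    assert (Hl' : l' <> nil) by now subst.
    assert (Hm : map (Cminus c) l' <> nil) by now subst.
    replace (length l' + 1 - 1)%nat with (S (length l' - 1)) by (subst; cbn; lia).
    clear a l E.
    apply (first_order_unique (c - m) (fundamental_function (map (Cminus c) l' ++ [c - m]))
      (fun t => (- 1) ^ S (length l' - 1) * (cexp c t * fundamental_function (l' ++ [m]) (- t)%R))
      (fundamental_function (map (Cminus c) l'))).
    + intros y. now apply is_CDeriv_fundamental_snoc.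
    + intros y. evar_last.
      { apply is_CDeriv_scal, is_CDeriv_mult; [apply is_CDeriv_cexp|].
        now apply is_CDeriv_reflect, is_CDeriv_fundamental_snoc. }
      rewrite IH by exact Hl'. cbn [Cpow]. ring.
    + rewrite Ropp_0, !fundamental_snoc_0 by assumption. ring.
Qed.

(** Peeling the factors of [r] off one by one leaves the fundamental function of [[m]]. *)
Lemma diff_op_fundamental_cons (m : C) (r : list C) :
  diff_op r (fundamental_function (m :: r)) = cexp m.
Proof.
  induction r as [|a r IH] using rev_ind.
  - apply functional_extensionality, fundamental_function_singleton.
  - rewrite diff_op_snoc, app_comm_cons, fundamental_function_peel by easy. exact IH.
Qed.

(** The operators of [l] and [r] commute, so applying both to the common function and evaluating at 0
    gives 0 in one order and the characteristic polynomial of [l] at [m] in the other. *)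
Lemma fundamental_eq_In (m : C) (r l : list C) :
  l <> nil ->
  locally 0%R (fun x => fundamental_function (m :: r) x = fundamental_function l x) -> In m l.
Proof.
  intros Hl H.
  assert (Z : diff_op l (cexp m) 0%R = 0).
  { rewrite <- (diff_op_fundamental_cons m r), <- diff_op_app.
    rewrite (diff_op_Permutation _ _ _ (Permutation_app_comm l r))
      by now apply smooth_fundamental_function.
    rewrite diff_op_app, <- (diff_op_zero r 0%R).
    apply (locally_singleton (T := R_UniformSpace) 0%R (fun x => _ x = _ x)), diff_op_ext_loc.
    generalize (diff_op_ext_loc l _ _ _ H). apply filter_imp. intros x ->.
    now apply fundamental_ode, fundamental_function_spec. }
  rewrite diff_op_cexp, cexp_0, Cmult_1_r in Z.
  apply Cmult_fold_zero, in_map_iff in Z as [a [E Ha]].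
  replace m with a; [exact Ha|].
  transitivity (m - (m - a)); [ring|]. rewrite E. ring.
Qed.

(** Once [m] is found in [l'], permutation invariance moves it to the end of both lists, where
    peeling cancels it. *)
Lemma fundamental_eq_Permutation (l l' : list C) :
  length l = length l' ->
  locally 0%R (fun x => fundamental_function l x = fundamental_function l' x) ->
  Permutation l l'.
Proof.
  revert l'. induction l as [|m r IH]; intros l' HL H.
  - now destruct l'.
  - assert (Hl' : l' <> nil) by now destruct l'.
    destruct (in_split m l' (fundamental_eq_In m r l' Hl' H)) as [u [v ->]].
    apply Permutation_cons_app, IH; [rewrite length_app in *; cbn in HL; lia|].
    assert (HL' : length r = length (u ++ v)) by (rewrite length_app in *; cbn in HL; lia).
    destruct r as [|a r].
    { destruct (u ++ v); [|easy]. now apply filter_forall. }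
    assert (Hr : a :: r <> nil) by easy. remember (a :: r) as r' eqn:E. clear E a r.
    assert (Huv : u ++ v <> nil) by (destruct (u ++ v); [now destruct r'|easy]).
    rewrite <- (fundamental_function_peel r' m Hr), <- (fundamental_function_peel (u ++ v) m Huv).
    apply (diff_op_ext_loc [m]). revert H. apply filter_imp. intros x Hx.
    rewrite (fundamental_function_Permutation (r' ++ [m]) (m :: r')).
    + rewrite Hx. apply fundamental_function_Permutation; [now destruct u|].
      rewrite <- app_assoc. apply Permutation_app_head, Permutation_cons_append.
    + now destruct r'.
    + apply Permutation_sym, Permutation_cons_append.
Qed.

(** * Symmetric vectors *)

Lemma symmetric_vector_Permutation (mu : list C) :
  symmetric_vector mu <-> Permutation mu (map Copp mu).
Proof.
  assert (N : forall j, nth j (map Copp mu) 0 = - nth j mu 0).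
  { intros j. rewrite <- (map_nth Copp). replace (- RtoC 0) with (RtoC 0) by ring. reflexivity. }
  rewrite (Permutation_nth mu (map Copp mu) 0). cbn zeta.
  rewrite length_map. split.
  - intros (p & Hp & Hi & H). split; [reflexivity|]. exists p. repeat split; auto.
    intros j Hj. rewrite N. auto.
  - intros (_ & p & Hp & Hi & H). exists p. repeat split; auto.
    intros j Hj. rewrite <- N. auto.
Qed.

Lemma Csum_Permutation (l l' : list C) :
  Permutation l l' -> fold_right Cplus 0 l = fold_right Cplus 0 l'.
Proof.
  intros H. induction H; cbn; congruence || ring.
Qed.

Lemma double_eq_0 (z : C) : z = - z -> z = 0.
Proof.
  destruct z as [a b]. intros [= Ha Hb]. apply injective_projections; simpl; lra.
Qed.

Lemma symmetric_vector_sum (mu : list C) :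
  symmetric_vector mu -> fold_right Cplus 0 mu = 0.
Proof.
  intros H%symmetric_vector_Permutation%Csum_Permutation. apply double_eq_0.
  rewrite H at 1. clear H. induction mu as [|a mu IH]; cbn; [|rewrite IH]; ring.
Qed.

Lemma map_Cminus_0 (mu : list C) : map (Cminus 0) mu = map Copp mu.
Proof. apply map_ext. intros a. ring. Qed.

Lemma symmetric_iff_fundamental_odd (l0 l1 l2 l3 : C) :
  symmetric_vector [l0; l1; l2; l3] <->
  forall x, fundamental_function [l0; l1; l2; l3] (- x)%R
            = - fundamental_function [l0; l1; l2; l3] x.
Proof.
  set (mu := [l0; l1; l2; l3]).
  assert (E : forall x, fundamental_function mu (- x)%R = - fundamental_function (map Copp mu) x).
  { intros x. rewrite <- map_Cminus_0, fundamental_function_reflect by easy.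
    replace (cexp 0 x) with (RtoC 1).
    - cbn [length mu Nat.sub Cpow]. ring.
    - rewrite <- (cexp_0 0). unfold cexp. simpl. now rewrite !Rmult_0_l. }
  rewrite symmetric_vector_Permutation. split.
  - intros H x. rewrite E. f_equal. symmetry. now apply fundamental_function_Permutation.
  - intros H. apply fundamental_eq_Permutation; [reflexivity|]. apply filter_forall. intros x.
    transitivity (- - fundamental_function mu x); [ring|]. rewrite <- H, E. ring.
Qed.

(** * Fundamental functions with two exponents *)

(** With [c = a + b], the list c - [a; b] is [b; a], which has the same fundamental function. *)
Lemma fundamental2_reflect (a b : C) (x : R) :
  fundamental_function [a; b] x = - (cexp (a + b) x * fundamental_function [a; b] (- x)%R).
Proof.
  pose proof (fundamental_function_reflect (a + b) [a; b] x ltac:(easy)) as H.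
  cbn [map length Nat.sub Cpow] in H.
  replace (a + b - a) with b in H by ring. replace (a + b - b) with a in H by ring.
  rewrite (fundamental_function_Permutation [a; b] [b; a]) at 1 by (easy || constructor).
  rewrite H. ring.
Qed.

Lemma fundamental2_opp_neq_0 (a b : C) (x : R) :
  fundamental_function [a; b] x <> 0 -> fundamental_function [a; b] (- x)%R <> 0.
Proof. intros H E. apply H. rewrite fundamental2_reflect, E. ring. Qed.

Lemma fundamental2_0 (a b : C) : fundamental_function [a; b] 0%R = 0.
Proof. now apply (fundamental_snoc_0 [a]). Qed.

(** The zero at 0 is isolated because the derivative there is 1. *)
Lemma fundamental2_neq_0_near_0 (a b : C) :
  locally 0%R (fun x => x <> 0%R -> fundamental_function [a; b] x <> 0).
Proof.
  pose proof (is_CDeriv_fundamental_snoc [a] b 0%R ltac:(easy)) as H.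
  cbn [app] in H.
  rewrite fundamental2_0, fundamental_function_singleton, cexp_0 in H.
  apply is_CDeriv_pair in H as [H _].
  apply is_derive_Reals in H.
  destruct (H 1%R Rlt_0_1) as [d Hd]. exists d. intros x Hx Nx E.
  specialize (Hd x Nx). rewrite Rplus_0_l, E, fundamental2_0 in Hd.
  assert (Hx' : (Rabs x < d)%R).
  { replace x with (minus x 0%R); [exact Hx|]. unfold minus, plus, opp; simpl. ring. }
  specialize (Hd Hx').
  replace (_ - _)%R with (-1)%R in Hd.
  - apply Rabs_def2 in Hd. lra.
  - simpl. field. exact Nx.
Qed.

(** * The function sigma and the matrix R *)

Lemma rho_sigma_domain_opp (l0 l1 l2 l3 : C) (x : R) :
  rho_sigma_domain l0 l1 l2 l3 x -> rho_sigma_domain l0 l1 l2 l3 (- x)%R.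
Proof. intros [H1 H2]. split; now apply fundamental2_opp_neq_0. Qed.

(** The denominator picks up the factor e^{- s x} under reflection, s being the sum of the exponents,
    and e^{s x} times the reflected numerator is again, up to sign, a fundamental function. *)
Lemma sigma_opp (l0 l1 l2 l3 : C) (x : R) :
  rho_sigma_domain l0 l1 l2 l3 x ->
  sigma_fun l0 l1 l2 l3 (- x)%R
  = - (fundamental_function
         (map (Cminus (fold_right Cplus 0 [l0; l1; l2; l3])) [l0; l1; l2; l3]) x
       / (fundamental_function [l0; l1] x * fundamental_function [l2; l3] x)).
Proof.
  intros [H1 H2].
  set (s := fold_right Cplus 0 [l0; l1; l2; l3]).
  assert (Es : s = (l0 + l1) + (l2 + l3)) by (unfold s; cbn; ring).
  assert (Ee : cexp s x = cexp (l0 + l1) x * cexp (l2 + l3) x) by (rewrite Es; apply cexp_plus).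
  pose proof (fundamental2_opp_neq_0 _ _ _ H1) as N1.
  pose proof (fundamental2_opp_neq_0 _ _ _ H2) as N2.
  unfold sigma_fun. rewrite (fundamental_function_reflect s) by easy.
  rewrite (fundamental2_reflect l0 l1 x), (fundamental2_reflect l2 l3 x), Ee.
  cbn [length Nat.sub Cpow]. field.
  repeat split; try assumption; apply cexp_neq_0.
Qed.

Lemma symmetric_sigma_odd (l0 l1 l2 l3 : C) :
  symmetric_vector [l0; l1; l2; l3] ->
  odd_on (rho_sigma_domain l0 l1 l2 l3) (sigma_fun l0 l1 l2 l3).
Proof.
  intros H. split; [apply rho_sigma_domain_opp|]. intros x Hx.
  rewrite sigma_opp by exact Hx.
  rewrite (symmetric_vector_sum _ H), map_Cminus_0.
  now rewrite <- (fundamental_function_Permutation [l0; l1; l2; l3])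
    by (easy || now apply symmetric_vector_Permutation).
Qed.

(** Oddness of sigma is only known on its domain, which is why the injectivity of fundamental
    functions is needed in its local form near 0. *)
Lemma sigma_odd_symmetric (l0 l1 l2 l3 : C) :
  (forall x, rho_sigma_domain l0 l1 l2 l3 x ->
     sigma_fun l0 l1 l2 l3 (- x)%R = - sigma_fun l0 l1 l2 l3 x) ->
  symmetric_vector [l0; l1; l2; l3].
Proof.
  intros H. set (mu := [l0; l1; l2; l3]). set (s := fold_right Cplus 0 mu).
  assert (HP : Permutation (map (Cminus s) mu) mu).
  { apply fundamental_eq_Permutation; [reflexivity|].
    generalize (filter_and _ _ (fundamental2_neq_0_near_0 l0 l1) (fundamental2_neq_0_near_0 l2 l3)).
    apply filter_imp. intros x [H1 H2].
    destruct (Req_dec x 0) as [->|Nx].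
    - (* At 0, outside the domain of sigma, both functions vanish. *)
      transitivity (RtoC 0); [|symmetry]; now apply (fundamental_snoc_0 [_; _; _]).
    - specialize (H1 Nx). specialize (H2 Nx).
      specialize (H x (conj H1 H2)). rewrite sigma_opp in H by now split.
      unfold sigma_fun in H. fold mu s in H.
      set (P := fundamental_function [l0; l1] x * fundamental_function [l2; l3] x) in H.
      assert (NP : P <> 0) by now apply Cmult_neq_0.
      transitivity (- - (fundamental_function (map (Cminus s) mu) x / P) * P); [now field|].
      rewrite H. now field. }
  (* The sum over map (Cminus s) mu is 4 s - s, so the permutation forces 3 s = s. *)
  assert (Hs : s = 0).
  { apply double_eq_0. pose proof (Csum_Permutation _ _ HP) as E. fold s in E.
    transitivity (s + s - s); [ring|]. rewrite <- E at 3. unfold s. cbn. ring. }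
  apply symmetric_vector_Permutation, Permutation_sym.
  now rewrite <- map_Cminus_0, <- Hs.
Qed.

Lemma sigma_odd_Rmat_symmetric (l0 l1 l2 l3 : C) (n : nat) (t : nat -> R) :
  odd_on (rho_sigma_domain l0 l1 l2 l3) (sigma_fun l0 l1 l2 l3) ->
  interpolation_points l0 l1 l2 l3 n t ->
  symmetric_matrix n (Rmat l0 l1 l2 l3 t).
Proof.
  intros [_ Hodd] [_ HD].
  assert (U : forall i, (2 <= i <= n - 1)%nat ->
    Rmat l0 l1 l2 l3 t i (i + 1) = Rmat l0 l1 l2 l3 t (i + 1) i).
  { intros i Hi. unfold Rmat.
    replace (i =? i + 1)%nat with false by (symmetry; apply Nat.eqb_neq; lia).
    replace (i + 1 =? i)%nat with false by (symmetry; apply Nat.eqb_neq; lia).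
    replace (i =? i + 1 + 1)%nat with false by (symmetry; apply Nat.eqb_neq; lia).
    rewrite Nat.eqb_refl, Hodd by (apply HD; lia). ring. }
  intros i j Hi Hj.
  destruct (Nat.eq_dec j (i + 1)) as [->|N1]; [now apply U|].
  destruct (Nat.eq_dec i (j + 1)) as [->|N2]; [symmetry; now apply U|].
  unfold Rmat.
  destruct (Nat.eqb_spec i j) as [->|N3]; [now rewrite Nat.eqb_refl|].
  apply Nat.eqb_neq in N1, N2. rewrite N1, N2.
  now replace (j =? i)%nat with false by (symmetry; apply Nat.eqb_neq; lia).
Qed.

(** The points x, 2 x, 3 x, 4 x have all gaps equal to [x], and the entries (2, 3) and (3, 2) of the
    2 x 2 matrix for [n = 4] compare sigma (x) with - sigma (- x). Negative arguments follow since
    the domain is symmetric, and 0 is not in it. *)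
Lemma Rmat_symmetric_sigma_odd (l0 l1 l2 l3 : C) :
  (forall (n : nat) (t : nat -> R),
     (3 <= n)%nat ->
     interpolation_points l0 l1 l2 l3 n t ->
     symmetric_matrix n (Rmat l0 l1 l2 l3 t)) ->
  forall x, rho_sigma_domain l0 l1 l2 l3 x ->
    sigma_fun l0 l1 l2 l3 (- x)%R = - sigma_fun l0 l1 l2 l3 x.
Proof.
  intros H.
  assert (Pos : forall x, (0 < x)%R -> rho_sigma_domain l0 l1 l2 l3 x ->
    sigma_fun l0 l1 l2 l3 (- x)%R = - sigma_fun l0 l1 l2 l3 x).
  { intros x Hx HD.
    set (t := fun j => (INR j * x)%R).
    assert (G : forall j, (t (j + 1)%nat - t j)%R = x).
    { intros j. unfold t. rewrite plus_INR. simpl. ring. }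
    assert (E : Rmat l0 l1 l2 l3 t 2 3 = Rmat l0 l1 l2 l3 t 3 2).
    { apply (H 4%nat); try lia. split; intros j _.
      - specialize (G j). lra.
      - now rewrite G. }
    change (Rmat l0 l1 l2 l3 t 2 3) with (sigma_fun l0 l1 l2 l3 (t (2 + 1)%nat - t 2%nat)%R) in E.
    change (Rmat l0 l1 l2 l3 t 3 2)
      with (- sigma_fun l0 l1 l2 l3 (- (t (2 + 1)%nat - t 2%nat))%R) in E.
    rewrite G in E. rewrite E. ring. }
  intros x HD. destruct (Rtotal_order x 0) as [Hx|[->|Hx]].
  - assert (E := Pos (- x)%R ltac:(lra) (rho_sigma_domain_opp _ _ _ _ _ HD)).
    rewrite Ropp_involutive in E. rewrite E. ring.
  - destruct HD as [HD _]. now destruct HD; apply fundamental2_0.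
  - now apply Pos.
Qed.

Theorem theorem31 (l0 l1 l2 l3 : C) :
  (symmetric_vector [l0; l1; l2; l3]
   <-> odd_on (rho_sigma_domain l0 l1 l2 l3) (sigma_fun l0 l1 l2 l3)) /\
  (symmetric_vector [l0; l1; l2; l3]
   <-> forall (n : nat) (t : nat -> R),
         (3 <= n)%nat ->
         interpolation_points l0 l1 l2 l3 n t ->
         symmetric_matrix n (Rmat l0 l1 l2 l3 t)) /\
  (symmetric_vector [l0; l1; l2; l3]
   <-> forall x : R, fundamental_function [l0; l1; l2; l3] (- x)%R
                       = - fundamental_function [l0; l1; l2; l3] x).
Proof.
  split; [|split].
  - split; [apply symmetric_sigma_odd|]. intros [_ H]. now apply sigma_odd_symmetric.
  - split.
    + intros H n t _. now apply sigma_odd_Rmat_symmetric, symmetric_sigma_odd.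
    + intros H. now apply sigma_odd_symmetric, Rmat_symmetric_sigma_odd.
  - apply symmetric_iff_fundamental_odd.
Qed.
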